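(* Let $\mathfrak X$ be a class of locally finite groups closed under taking subgroups and quotients. Then the Addition Theorem holds in $\mathfrak X$ for endomorphisms if and only if it holds for endomorphisms of every group in $\mathfrak X$ that is generated by a bounded subset. That is, the following are equivalent: (i) for every $G\in\mathfrak X$, every endomorphism $\phi$ of $G$ and every normal subgroup $H$ of $G$ with $\phi(H)\subseteq H$, one has $h(\phi)=h(\phi\upharpoonright_H)+h(\bar\phi_{G/H})$; (ii) the same equality holds for every $G\in\mathfrak X$ that is generated by a bounded subset, every endomorphism $\phi$ of $G$ and every normal subgroup $H$ of $G$ with $\phi(H)\subseteq H$.
   Context: Algebraic entropy: for a group $G$, an endomorphism $\phi$ of $G$ and a non-empty finite subset $F\subseteq G$, put $T_n(\phi,F)=F\,\phi(F)\cdots\phi^{n-1}(F)$ (product of subsets) for each integer $n\ge 1$, and $H(\phi,F)=\limsup_{n\to\infty}\frac1n\log|T_n(\phi,F)|$ (in fact a limit). The algebraic entropy of $\phi$ is $h(\phi)=\sup_F H(\phi,F)\in[0,\infty]$, where $F$ ranges over all non-empty finite subsets of $G$. Sums are taken in $[0,\infty]$ with the usual convention $x+\infty=\infty$. For a normal subgroup $H$ of $G$ with $\phi(H)\subseteq H$, $\phi\upharpoonright_H$ denotes the restriction of $\phi$ to $H$ and $\bar\phi_{G/H}$ the endomorphism of $G/H$ induced by $\phi$. A group is locally finite if each of its finitely generated subgroups is finite. A subset of a group is bounded if the orders of its elements are uniformly bounded (there is a positive integer $N$ such that every element of the subset has finite order at most $N$). *)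

(* Defs.v *)
From HB Require Import structures.
From mathcomp Require Import all_boot all_order all_algebra.
From mathcomp Require Import finmap generic_quotient.
From mathcomp Require Import boolp classical_sets cardinality.
From mathcomp Require Import reals ereal normedtype sequences exp.

Set Implicit Arguments.
Unset Strict Implicit.
Unset Printing Implicit Defensive.

Local Open Scope classical_set_scope.
Local Open Scope group_scope.

(* [groupType] does not require finiteness.  A [groupClosed G] packs a boolean *)
(* predicate, but classically every [set G] has one: no decidability is lost.  *)

Notation endomorphism G := (UMagmaMorphism.type G G).

Section Subgroup.
Variables (G : groupType) (H : groupClosed G).

Definition subgroup := {x : G | x \in H}.

HB.instance Definition _ := SubChoice.on subgroup.

Fact subgroup_group_closed : group_closed (fun x : G => x \in H).
Proof. by split=> [|x y Hx Hy]; [exact: gpred1 | exact: gpredF]. Qed.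

HB.instance Definition _ :=
  SubChoice_isSubGroup.Build G (fun x : G => x \in H) subgroup
    subgroup_group_closed.

End Subgroup.

Record normalSubgroup (G : groupType) := NormalSubgroup {
  normal_group :> groupClosed G;
  normalJ : forall x y : G, x \in normal_group -> x ^ y \in normal_group
}.

Section Quotient.
Variables (G : groupType) (N : normalSubgroup G).

Definition same_coset (x y : G) : bool := x^-1 * y \in N.

Fact same_coset_refl : reflexive same_coset.
Proof. by move=> x; rewrite /same_coset mulVg gpred1. Qed.

Fact same_coset_sym : symmetric same_coset.
Proof.
have sub x y : same_coset x y -> same_coset y x.
  by rewrite /same_coset => /gpredVr; rewrite invgM invgK.
by move=> x y; apply/idP/idP; exact: sub.
Qed.

Fact same_coset_trans : transitive same_coset.
Proof.
move=> y x z; rewrite /same_coset => xy yz.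
by have := gpredM _ _ xy yz; rewrite -mulgA mulVKg.
Qed.

Canonical same_coset_equiv :=
  EquivRel same_coset same_coset_refl same_coset_sym same_coset_trans.

Definition quotient := {eq_quot same_coset}%qT.

HB.instance Definition _ := EqQuotient.on quotient.
HB.instance Definition _ := Choice.on quotient.

Local Open Scope quotient_scope.

Definition quot_one : quotient := \pi_(quotient) 1.
Definition quot_inv (a : quotient) : quotient := \pi_(quotient) (repr a)^-1.
Definition quot_mul (a b : quotient) : quotient :=
  \pi_(quotient) (repr a * repr b).

Fact pi_quotP (x y : G) :
  \pi_(quotient) x = \pi_(quotient) y <-> x^-1 * y \in N.
Proof. by split=> [/eqmodP|h]; last exact/eqmodP. Qed.

Fact repr_coset (x : G) : x^-1 * repr (\pi_(quotient) x) \in N.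
Proof. by apply/pi_quotP; rewrite reprK. Qed.

Fact pi_quotM (x y : G) :
  quot_mul (\pi_(quotient) x) (\pi_(quotient) y) = \pi_(quotient) (x * y).
Proof.
apply/esym/pi_quotP.
set a := repr _; set b := repr _.
have -> : (x * y)^-1 * (a * b) = (y^-1 * b) * ((x^-1 * a) ^ b).
  by rewrite conjgE invgM !mulgA mulgK.
by apply: gpredM; [|apply: normalJ]; exact: repr_coset.
Qed.

Fact pi_quotV (x : G) : quot_inv (\pi_(quotient) x) = \pi_(quotient) x^-1.
Proof.
apply/esym/pi_quotP; rewrite invgK.
have := normalJ x^-1 (gpredVr _ (repr_coset x)).
by rewrite conjgE invgM !invgK !mulgA mulgK.
Qed.

Fact quot_mulA : associative quot_mul.
Proof.
move=> a b c; rewrite -[a]reprK -[b]reprK -[c]reprK.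
move: (repr a) (repr b) (repr c) => x y z.
by rewrite (pi_quotM x y) (pi_quotM y z) (pi_quotM (x * y)) (pi_quotM x) mulgA.
Qed.

Fact quot_mul1q : left_id quot_one quot_mul.
Proof. by move=> a; rewrite -[a]reprK pi_quotM mul1g. Qed.

Fact quot_mulq1 : right_id quot_one quot_mul.
Proof. by move=> a; rewrite -[a]reprK pi_quotM mulg1. Qed.

Fact quot_mulVq : left_inverse quot_one quot_inv quot_mul.
Proof. by move=> a; rewrite -[a]reprK pi_quotV pi_quotM mulVg. Qed.

Fact quot_mulqV : right_inverse quot_one quot_inv quot_mul.
Proof. by move=> a; rewrite -[a]reprK pi_quotV pi_quotM mulgV. Qed.

HB.instance Definition _ := isGroup.Build quotient
  quot_mulA quot_mul1q quot_mulq1 quot_mulVq quot_mulqV.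

End Quotient.

Definition invariant_subgroup (G : groupType) (phi : endomorphism G)
    (H : groupClosed G) : Prop :=
  forall x : G, x \in H -> phi x \in H.

Section Restriction.
Variables (G : groupType) (phi : endomorphism G) (H : groupClosed G).
Hypothesis phiH : invariant_subgroup phi H.

Definition restriction_fun (x : subgroup H) : subgroup H :=
  exist _ (phi (val x)) (phiH (valP x)).

Fact restriction_funF : {morph restriction_fun : x y / x / y}.
Proof. by move=> x y; apply/val_inj; rewrite /= gmulfF. Qed.

HB.instance Definition _ :=
  isGroupMorphism.Build _ _ restriction_fun restriction_funF.

Definition restriction : endomorphism (subgroup H) := restriction_fun.

End Restriction.

Section Induced.
Variables (G : groupType) (phi : endomorphism G) (N : normalSubgroup G).
Hypothesis phiN : invariant_subgroup phi N.

Local Open Scope quotient_scope.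

Definition induced_fun (a : quotient N) : quotient N :=
  \pi_(quotient N) (phi (repr a)).

Fact induced_funE (x : G) :
  induced_fun (\pi_(quotient N) x) = \pi_(quotient N) (phi x).
Proof.
apply/esym/pi_quotP; rewrite -gmulfV -gmulfM.
exact/phiN/repr_coset.
Qed.

Fact induced_funF : {morph induced_fun : a b / a / b}.
Proof.
move=> a b; rewrite -[a]reprK -[b]reprK; move: (repr a) (repr b) => x y.
have -> : \pi_(quotient N) x / \pi_(quotient N) y = \pi_(quotient N) (x / y).
  by rewrite -pi_quotM -pi_quotV.
by rewrite !induced_funE gmulfF -pi_quotM -pi_quotV.
Qed.

HB.instance Definition _ :=
  isGroupMorphism.Build _ _ induced_fun induced_funF.

Definition induced : endomorphism (quotient N) := induced_fun.

End Induced.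

Section Entropy.
Variables (R : realType) (G : groupType) (phi : endomorphism G).
Implicit Types A B F : {fset G}.

Definition fset_mul A B : {fset G} := [fset x * y | x in A, y in B]%fset.

Definition trajectory (n : nat) F : {fset G} :=
  \big[fset_mul/[fset 1]%fset]_(i < n) [fset iter i phi x | x in F]%fset.

(* The junk value at [n = 0] does not affect the upper limit. *)
Definition entropy_wrt F : \bar R :=
  limn_esup (fun n => ((n%:R)^-1 * ln (#|` trajectory n F|%:R))%:E%R).

Definition entropy : \bar R :=
  ereal_sup [set entropy_wrt F | F in [set F | F != fset0]].

End Entropy.

Section GroupClasses.
Variable G : groupType.

Definition generated (A : set G) : set G :=
  \bigcap_(H in [set H : groupClosed G | A `<=` [set` H]]) [set` H].

Definition locally_finite : Prop :=
  forall H : groupClosed G,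
    (exists2 F : set G, finite_set F & [set` H] = generated F) ->
  finite_set [set` H].

Definition has_order (x : G) (n : nat) : Prop :=
  [/\ (0 < n)%N, x ^+ n = 1 &
      forall m : nat, (0 < m)%N -> x ^+ m = 1 -> (n <= m)%N].

Definition bounded_subset (A : set G) : Prop :=
  exists2 N : nat, (0 < N)%N &
    forall x, A x -> exists2 n : nat, has_order x n & (n <= N)%N.

Definition boundedly_generated : Prop :=
  exists2 A : set G, bounded_subset A & generated A = setT.

End GroupClasses.

Definition addition_theorem (R : realType) (G : groupType) : Prop :=
  forall (phi : endomorphism G) (H : normalSubgroup G)
      (phiH : invariant_subgroup phi H),
    entropy R phi =
      (entropy R (restriction phiH) + entropy R (induced phiH))%E.

(* Main.v *)
Require Import Defs.
From mathcomp Require Import all_boot all_algebra reals.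
From HB Require Import structures.
From mathcomp Require Import all_order.
From mathcomp Require Import finmap generic_quotient.
From mathcomp Require Import boolp classical_sets cardinality.
From mathcomp Require Import ereal normedtype sequences exp.

Set Implicit Arguments.
Unset Strict Implicit.
Unset Printing Implicit Defensive.

(** Only the passage from boundedly generated groups to all of the class needs
    an argument, and it rests on two facts.

    The Addition Theorem is local ([addition_local]).  Suppose that every finite
    subset of [G] lies in some [phi]-invariant subgroup [K] whose endomorphisms
    satisfy it.  The restriction of [phi] to [K] has the invariant normal
    subgroup [trace H K], the intersection of [H] and [K], and each of the three
    entropies attached to this data is the entropy of a system that embeds in
    the corresponding system for [G]: [K] in [G], [trace H K] in [H], and
    [K / trace H K] in [G / H], the last by the second isomorphism theorem.  An injective equivariant morphism maps
    trajectories bijectively onto trajectories, so it preserves the growth rate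
    of each finite set ([entropy_wrt_imfset]).  Hence the entropies over [K] are
    at most those over [G], while any finite sets chosen in [G], or in [H] and
    [G / H] at once, are already visible over a suitable [K].  The equality over
    each [K] then yields both inequalities over [G].

    Such subgroups [K] exist and can be taken boundedly generated.  In a locally
    finite group each element has finite order, so a finite set [F] has a common
    exponent [e > 0], and [K] is the subgroup generated by all solutions of
    [x ^+ e = 1].  It is invariant under every endomorphism, because
    endomorphisms preserve that equation, and it belongs to the class because
    the class is closed under subgroups. *)

Import Order.TTheory Num.Theory.

Local Open Scope classical_set_scope.
Local Open Scope group_scope.

(** * Preimages, images and generated subgroups *)

Section Preimage.
Variables (G G' : groupType) (f : UMagmaMorphism.type G G') (H : groupClosed G').

Definition preim_pred : {pred G} := fun x => f x \in H.

Fact preim_pred1 : 1 \in preim_pred.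
Proof. by have : f 1 \in H by rewrite gmulf1 gpred1. Qed.
Fact preim_predM : mulg_closed preim_pred.
Proof.
move=> x y xH yH; have : f (x * y) \in H by rewrite gmulfM; exact: gpredM.
exact.
Qed.
Fact preim_predV : invg_closed preim_pred.
Proof.
move=> x xH; have : f x^-1 \in H by rewrite gmulfV; exact: gpredVr.
exact.
Qed.

HB.instance Definition _ := isMulClosed.Build G preim_pred preim_predM.
HB.instance Definition _ := isMul1Closed.Build G preim_pred preim_pred1.
HB.instance Definition _ := isInvClosed.Build G preim_pred preim_predV.

Definition preim_group : groupClosed G := preim_pred.

End Preimage.

Section Image.
Variables (G G' : groupType) (f : UMagmaMorphism.type G G') (H : groupClosed G).

Definition image_pred : {pred G'} := fun y => `[< exists2 x, x \in H & f x = y >].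

Fact image_pred1 : 1 \in image_pred.
Proof. by apply/asboolP; exists 1; [exact: gpred1|exact: gmulf1]. Qed.
Fact image_predM : mulg_closed image_pred.
Proof.
move=> _ _ /asboolP[x xH <-] /asboolP[y yH <-]; apply/asboolP.
by exists (x * y); [exact: gpredM|exact: gmulfM].
Qed.
Fact image_predV : invg_closed image_pred.
Proof.
move=> _ /asboolP[x xH <-]; apply/asboolP.
by exists x^-1; [exact: gpredVr|exact: gmulfV].
Qed.

HB.instance Definition _ := isMulClosed.Build G' image_pred image_predM.
HB.instance Definition _ := isMul1Closed.Build G' image_pred image_pred1.
HB.instance Definition _ := isInvClosed.Build G' image_pred image_predV.

Definition image_group : groupClosed G' := image_pred.

End Image.

Section Generated.
Variables (G : groupType) (A : set G).

Definition generated_pred : {pred G} := fun x => `[< generated A x >].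

Fact generated_pred1 : 1 \in generated_pred.
Proof. by apply/asboolP => H _; exact: gpred1. Qed.
Fact generated_predM : mulg_closed generated_pred.
Proof.
move=> x y /asboolP Ax /asboolP Ay; apply/asboolP => H AH.
by apply: gpredM; [exact: Ax|exact: Ay].
Qed.
Fact generated_predV : invg_closed generated_pred.
Proof.
by move=> x /asboolP Ax; apply/asboolP => H AH; apply: gpredVr; exact: Ax.
Qed.

HB.instance Definition _ := isMulClosed.Build G generated_pred generated_predM.
HB.instance Definition _ := isMul1Closed.Build G generated_pred generated_pred1.
HB.instance Definition _ := isInvClosed.Build G generated_pred generated_predV.

Definition generated_group : groupClosed G := generated_pred.

Lemma mem_generated x : A x -> x \in generated_group.
Proof. by move=> Ax; apply/asboolP => H; exact. Qed.

Lemma generated_group_min (H : groupClosed G) :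
  A `<=` [set` H] -> {subset generated_group <= H}.
Proof. by move=> AH x /asboolP; exact. Qed.

End Generated.

(** * Suprema of sums *)

(** Taking the suprema one variable at a time requires subtraction, which is
    legitimate once everything is finite; nonnegativity makes each summand
    finite as soon as the bound [c] is. *)
Lemma ereal_supD_le (R : realType) (A B : set (\bar R)) (c : \bar R) :
    A !=set0 -> B !=set0 ->
    (forall a, A a -> 0 <= a)%E -> (forall b, B b -> 0 <= b)%E ->
    (forall a b, A a -> B b -> a + b <= c)%E ->
  (ereal_sup A + ereal_sup B <= c)%E.
Proof.
move=> [a0 Aa0] [b0 Bb0] A0 B0 ABc.
have c0 : (0 <= c)%E.
  by apply: le_trans (ABc _ _ Aa0 Bb0); apply: adde_ge0; [exact: A0|exact: B0].
case: c c0 ABc => [c|_ _|//]; last exact: leey.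
move=> _ ABc.
have fin a b : (0 <= a -> 0 <= b -> a + b <= c%:E -> a \is a fin_num)%E.
  move=> a_ge0 b_ge0 abc; rewrite ge0_fin_numE//.
  by apply: le_lt_trans (ltry c); apply: le_trans abc; rewrite leeDl.
have supB a : A a -> (a + ereal_sup B <= c%:E)%E.
  move=> Aa; have a_fin := fin _ _ (A0 _ Aa) (B0 _ Bb0) (ABc _ _ Aa Bb0).
  rewrite addeC -leeBrDr//; apply: ge_ereal_sup => b Bb.
  by rewrite leeBrDr// addeC ABc.
have supB_ge0 : (0 <= ereal_sup B)%E.
  by apply: le_trans (B0 _ Bb0) _; exact: ereal_sup_ubound.
have supB_fin : ereal_sup B \is a fin_num.
  by apply: (fin _ a0) => //; [exact: A0|rewrite addeC; exact: supB].
rewrite -leeBrDr//; apply: ge_ereal_sup => a Aa.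
by rewrite leeBrDr// supB.
Qed.

(** * Entropy and injective equivariant morphisms *)

Section EntropyGe0.
Variables (R : realType) (G : groupType) (phi : endomorphism G).
Implicit Types F : {fset G}.

Lemma trajectory_neq0 n F : F != fset0 -> trajectory phi n F != fset0.
Proof.
case/fset0Pn => x xF.
apply: (@big_ind _ (fun A : {fset G} => A != fset0)) => [|A B|i _].
- by apply/fset0Pn; exists 1; rewrite in_fset1.
- case/fset0Pn => a aA /fset0Pn[b bB].
  by apply/fset0Pn; exists (a * b); apply/imfset2P; exists a => //; exists b.
- by apply/fset0Pn; exists (iter i phi x); apply/imfsetP; exists x.
Qed.

(** Holds because the trajectory is nonempty, so that its cardinality has a
    nonnegative logarithm. *)
Lemma entropy_wrt_ge0 F : F != fset0 -> (0 <= entropy_wrt R phi F)%E.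
Proof.
move=> F0; apply: limf_esup_ge0 => [|n]; first exact: filter_not_empty.
rewrite lee_fin mulr_ge0 ?invr_ge0 ?ler0n//.
by rewrite ln_ge0// ler1n cardfs_gt0 trajectory_neq0.
Qed.

Lemma entropy_wrt_le F : F != fset0 -> (entropy_wrt R phi F <= entropy R phi)%E.
Proof. by move=> F0; apply: ereal_sup_ubound; exists F. Qed.

End EntropyGe0.

Section Embedding.
Variables (R : realType) (G G' : groupType) (phi : endomorphism G).
Variables (phi' : endomorphism G') (f : UMagmaMorphism.type G G').
Hypothesis f_inj : injective f.
Hypothesis f_phi : forall x, f (phi x) = phi' (f x).

Lemma imfset_mul (A B : {fset G}) :
  (f @` fset_mul A B)%fset = fset_mul (f @` A)%fset (f @` B)%fset.
Proof.
apply/fsetP => z; apply/imfsetP/imfset2P => /=.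
- move=> [_ /imfset2P[a aA [b bB ->]] ->]; exists (f a).
    by apply/imfsetP; exists a.
  by exists (f b); [apply/imfsetP; exists b|rewrite gmulfM].
- move=> [_ /imfsetP[a aA ->] [_ /imfsetP[b bB ->] ->]].
  by exists (a * b); [apply/imfset2P; exists a => //; exists b|rewrite gmulfM].
Qed.

Lemma trajectory_imfset n (F : {fset G}) :
  trajectory phi' n (f @` F)%fset = (f @` trajectory phi n F)%fset.
Proof.
rewrite /trajectory (big_morph _ imfset_mul (_ : _ = [fset 1]%fset)); last first.
  by rewrite imfset_fset1 gmulf1.
apply: eq_bigr => i _; rewrite -!imfset_comp; apply: eq_imfset => //= x.
by elim: (i : nat) => //= k ->; rewrite f_phi.
Qed.

(** Trajectories are computed inside the image, where [f] is a bijection, so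
    they have the same cardinality on both sides. *)
Lemma entropy_wrt_imfset (F : {fset G}) :
  entropy_wrt R phi' (f @` F)%fset = entropy_wrt R phi F.
Proof.
congr limn_esup; apply/funext => n.
by rewrite trajectory_imfset card_imfset.
Qed.

Lemma entropy_le_embedding : (entropy R phi <= entropy R phi')%E.
Proof.
apply: ge_ereal_sup => _ [F F0 <-]; rewrite -entropy_wrt_imfset.
apply: entropy_wrt_le; case/fset0Pn: F0 => x xF.
by apply/fset0Pn; exists (f x); apply/imfsetP; exists x.
Qed.

(** The form in which finite sets of the large system are pulled back to the
    small one: choosing preimages of its points makes [F] the image of a finite
    set, whose growth rate is the same. *)
Lemma entropy_wrt_le_embedding (F : {fset G'}) :
    F != fset0 -> (forall y, y \in F -> exists x, f x = y) ->
  (entropy_wrt R phi' F <= entropy R phi)%E.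
Proof.
move=> F0 Ff.
have [g fg] : {g : G' -> G & forall y, y \in F -> f (g y) = y}.
  apply: (@choice _ _ (fun y x => y \in F -> f x = y)) => y.
  by have [/Ff[x <-]|yF] := boolP (y \in F); [exists x|exists 1].
have -> : F = (f @` (g @` F))%fset.
  apply/fsetP => y; apply/idP/imfsetP => /= [yF|[_ /imfsetP[x xF ->] ->]].
    by exists (g y); [apply/imfsetP; exists y|rewrite fg].
  by rewrite fg.
rewrite entropy_wrt_imfset; apply: entropy_wrt_le.
by case/fset0Pn: F0 => y yF; apply/fset0Pn; exists (g y); apply/imfsetP; exists y.
Qed.

End Embedding.

(** * The Addition Theorem is a local property *)

Section Trace.
Variables (G : groupType) (H : normalSubgroup G) (K : groupClosed G).

Let trace_group : groupClosed (subgroup K) := preim_group val H.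

Fact traceJ (x y : subgroup K) : x \in trace_group -> x ^ y \in trace_group.
Proof. exact: normalJ. Qed.

Definition trace : normalSubgroup (subgroup K) := NormalSubgroup traceJ.

Definition trace_embedding (x : subgroup trace) : subgroup H :=
  exist _ (val (val x)) (valP x).

Fact trace_embeddingF : {morph trace_embedding : x y / x / y}.
Proof. by move=> x y; apply/val_inj. Qed.

HB.instance Definition _ :=
  isGroupMorphism.Build _ _ trace_embedding trace_embeddingF.

Lemma trace_embedding_inj : injective trace_embedding.
Proof. by move=> x y [xy]; apply/val_inj/val_inj. Qed.

Local Open Scope quotient_scope.

(** The injection of the second isomorphism theorem, whose image is [K H / H]. *)
Definition quotient_embedding (a : quotient trace) : quotient H :=
  \pi_(quotient H) (val (repr a)).

Lemma quotient_embeddingE (x : subgroup K) :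
  quotient_embedding (\pi_(quotient trace) x) = \pi_(quotient H) (val x).
Proof. by apply/esym/pi_quotP; exact: (@repr_coset _ trace x). Qed.

Fact quotient_embeddingF : {morph quotient_embedding : a b / a / b}.
Proof.
move=> a b; rewrite -[a]reprK -[b]reprK; move: (repr a) (repr b) => x y.
have -> : \pi_(quotient trace) x / \pi_(quotient trace) y
    = \pi_(quotient trace) (x / y).
  by rewrite -pi_quotM -pi_quotV.
by rewrite !quotient_embeddingE -pi_quotM -pi_quotV.
Qed.

HB.instance Definition _ :=
  isGroupMorphism.Build _ _ quotient_embedding quotient_embeddingF.

Lemma quotient_embedding_inj : injective quotient_embedding.
Proof.
move=> a b; rewrite -[a]reprK -[b]reprK !quotient_embeddingE.
by move=> /pi_quotP abH; apply/pi_quotP.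
Qed.

End Trace.

Section Local.
Variables (R : realType) (G : groupType) (phi : endomorphism G).
Variables (H : normalSubgroup G) (phiH : invariant_subgroup phi H).
Local Open Scope quotient_scope.

Section OneSubgroup.
Variables (K : groupClosed G) (phiK : invariant_subgroup phi K).

Lemma trace_invariant : invariant_subgroup (restriction phiK) (trace H K).
Proof. by move=> x; exact: phiH. Qed.

Lemma trace_embedding_restriction x :
  trace_embedding (restriction trace_invariant x)
  = restriction phiH (trace_embedding x).
Proof. exact/val_inj. Qed.

Lemma quotient_embedding_induced a :
  quotient_embedding (induced trace_invariant a)
  = induced phiH (quotient_embedding a).
Proof.
rewrite -[a]reprK; move: (repr a) => x.
have -> : induced trace_invariant (\pi_(quotient _) x)
    = \pi_(quotient (trace H K)) (restriction phiK x).
  exact: (induced_funE trace_invariant x).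
by rewrite !quotient_embeddingE /=; exact/esym/(induced_funE phiH).
Qed.

End OneSubgroup.

(** For the bound from above, a finite set of [G] is pulled back to one [K].
    For the bound from below, a finite set of [H] and one of [G / H] must be
    seen over the same [K]; this is why the hypothesis is applied to the union
    of the former with a set of representatives of the latter. *)
Lemma addition_local :
    (forall F : {fset G}, exists K : groupClosed G,
      [/\ {subset F <= K}, invariant_subgroup phi K
        & addition_theorem R (subgroup K)]) ->
  entropy R phi = (entropy R (restriction phiH) + entropy R (induced phiH))%E.
Proof.
move=> local; apply/le_anti/andP; split.
- apply: ge_ereal_sup => _ [F F0 <-].
  have [K [FK phiK /(_ _ _ (trace_invariant phiK)) addK]] := local F.
  apply: (@le_trans _ _ (entropy R (restriction phiK))).
    apply: (@entropy_wrt_le_embedding _ _ _ _ _ val val_inj) => // y /FK yK.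
    by exists (exist _ y yK).
  rewrite addK; apply: leeD.
    exact: entropy_le_embedding (@trace_embedding_inj _ H K)
      (trace_embedding_restriction phiK).
  exact: entropy_le_embedding (@quotient_embedding_inj _ H K)
    (quotient_embedding_induced phiK).
- apply: ereal_supD_le => [| |_ [F F0 <-]|_ [F F0 <-]|_ _ [F1 F10 <-] [F2 F20 <-]].
  + exists (entropy_wrt R (restriction phiH) [fset 1]%fset), [fset 1]%fset => //=.
    by apply/fset0Pn; exists 1; rewrite in_fset1.
  + exists (entropy_wrt R (induced phiH) [fset 1]%fset), [fset 1]%fset => //=.
    by apply/fset0Pn; exists 1; rewrite in_fset1.
  + exact: entropy_wrt_ge0.
  + exact: entropy_wrt_ge0.
  have [K [FK phiK /(_ _ _ (trace_invariant phiK)) addK]] :=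
    local ([fset val x | x in F1] `|` [fset repr (a : quotient H) | a in F2])%fset.
  apply: (@le_trans _ _ (entropy R (restriction phiK))); last first.
    exact: (@entropy_le_embedding _ _ _ _ _ val val_inj).
  rewrite addK; apply: leeD.
    apply: entropy_wrt_le_embedding (@trace_embedding_inj _ H K)
      (trace_embedding_restriction phiK) _ F10 _ => y yF1.
    have yK : val y \in K.
      by apply: FK; rewrite in_fsetU; apply/orP; left; apply/imfsetP; exists y.
    have yH : exist _ (val y) yK \in trace H K := valP y.
    by exists (exist (fun x => x \in trace H K) _ yH); exact/val_inj.
  apply: entropy_wrt_le_embedding (@quotient_embedding_inj _ H K)
    (quotient_embedding_induced phiK) _ F20 _ => a aF2.
  have aK : repr a \in K.
    by apply: FK; rewrite in_fsetU; apply/orP; right; apply/imfsetP; exists a.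
  exists (\pi_(quotient (trace H K)) (exist _ (repr a) aK)).
  by rewrite [LHS]quotient_embeddingE /= reprK.
Qed.

End Local.

(** * Torsion, and the subgroups generated by the solutions of [x ^+ e = 1] *)

Lemma pow_eq1_has_order (G : groupType) (x : G) (e : nat) :
  (0 < e)%N -> x ^+ e = 1 -> exists2 n, has_order x n & (n <= e)%N.
Proof.
move=> e0 xe.
have ex_e : exists n, (0 < n)%N && (x ^+ n == 1) by exists e; rewrite e0 xe eqxx.
case: (ex_minnP ex_e) => n /andP[n0 /eqP xn] n_min.
exists n; last by rewrite n_min// e0 xe eqxx.
by split=> // m m0 xm; rewrite n_min// m0 xm eqxx.
Qed.

(** The powers of [x] lie in the finite group generated by [x], so two of them
    coincide. *)
Lemma locally_finite_torsion (G : groupType) : locally_finite G ->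
  forall x : G, exists2 n, (0 < n)%N & x ^+ n = 1.
Proof.
move=> lfG x; pose C := generated_group [set x].
have C_fin : finite_set [set` C].
  apply: lfG; exists [set x]; first exact: finite_set1.
  by apply/seteqP; split=> y /asboolP.
have xC n : x ^+ n \in C by apply/gpredXn/mem_generated.
have [/finite_preimage pow_fin|] :=
  pselect {in (fun n => x ^+ n) @^-1` [set` C] &, injective (fun n => x ^+ n)}.
  have := pow_fin C_fin; suff -> : (fun n => x ^+ n) @^-1` [set` C] = setT.
    by move/infinite_nat.
  by apply/seteqP; split=> // n _; exact: xC.
apply: contra_notP => no_order m n _ _ /=.
wlog mn : m n / (m <= n)%N.
  by case: (leqP m n) => [|/ltnW] nm W /esym xmn; [|apply/esym]; apply: W.
move=> xmn; apply/eqP; rewrite eqn_leq mn leqNgt; apply/negP => lt_mn.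
by apply: no_order; exists (n - m)%N; rewrite ?subn_gt0// expgnFr// xmn divgg.
Qed.

Lemma fset_exponent (G : groupType) (F : {fset G}) :
    (forall x : G, exists2 n, (0 < n)%N & x ^+ n = 1) ->
  exists2 e, (0 < e)%N & {in F, forall x, x ^+ e = 1}.
Proof.
move=> tors.
have /choice[ord ordP] : forall x : G, exists n, (0 < n)%N /\ x ^+ n = 1.
  by move=> x; have [n n0 xn] := tors x; exists n.
exists (\prod_(x <- F) ord x)%N; first by apply: prodn_gt0 => x; case: (ordP x).
move=> x xF; rewrite (big_rem x)//= expgnA (ordP x).2.
by elim: (\prod_(y <- _) _)%N => // n; rewrite expgS mul1g.
Qed.

Section Exponent.
Variables (G : groupType) (e : nat).

(** Solutions of [x ^+ e = 1] form a bounded set when [e > 0], and every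
    endomorphism maps them to solutions.  They need not form a subgroup, whence
    the passage to the generated one. *)
Definition exponent_group : groupClosed G := generated_group [set x | x ^+ e = 1].

Lemma exponent_group_invariant (phi : endomorphism G) :
  invariant_subgroup phi exponent_group.
Proof.
move=> x xK; have : x \in preim_group phi exponent_group; last exact.
apply: generated_group_min xK => y /= ye.
have : phi y \in exponent_group; last exact.
by apply: mem_generated; rewrite /= -gmulfXn ye gmulf1.
Qed.

(** Generation has to be shown inside the type [subgroup exponent_group]: a
    subgroup [H] of it containing the solutions is transported to [G] by
    [image_group], where minimality of the generated subgroup applies. *)
Lemma exponent_group_bounded :
  (0 < e)%N -> boundedly_generated (subgroup exponent_group).
Proof.
move=> e0; exists [set x | x ^+ e = 1].
  by exists e => // x xe; exact: pow_eq1_has_order.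
apply/seteqP; split=> // x _ H HA.
have : val x \in image_group val H.
  apply: generated_group_min (valP x) => y /= ye; apply/asboolP.
  have yK : y \in exponent_group by exact: mem_generated.
  exists (exist _ y yK) => //; apply: HA; apply/val_inj.
  by rewrite gmulfXn gmulf1.
by move=> /asboolP[z zH /val_inj <-].
Qed.

End Exponent.

Theorem corollary5p4 (R : realType) (X : groupType -> Prop)
    (X_locally_finite : forall G : groupType, X G -> locally_finite G)
    (X_subgroup : forall (G : groupType) (H : groupClosed G),
      X G -> X (subgroup H))
    (X_quotient : forall (G : groupType) (N : normalSubgroup G),
      X G -> X (quotient N)) :
  (forall G : groupType, X G -> addition_theorem R G) <->
  (forall G : groupType, X G -> boundedly_generated G ->
    addition_theorem R G).
Proof.
split=> [addX G XG _|add_bounded G XG phi H phiH]; first exact: addX.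
apply: addition_local => F.
have [e e0 Fe] := fset_exponent F (locally_finite_torsion (X_locally_finite G XG)).
exists (exponent_group G e); split.
- by move=> x /Fe xe; exact: mem_generated.
- exact: exponent_group_invariant.
- by apply: add_bounded; [exact: X_subgroup|exact: exponent_group_bounded].
Qed.
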